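(* Let $m\ge2$, let $X=Q_{2m-1}=\{x_0^2+x_1x_2+\cdots+x_{2m-1}x_{2m}=0\}\subset\mathbb{P}^{2m}$, and let $2\le j\le m$. On the affine open set $x_{2m}\ne0$ put $z_i=x_i/x_{2m}$ and $$\Omega_X^{(j)}:=\frac{dz_0dz_1\cdots dz_{2m-2}}{z_0A_2\cdots A_{j-1}B_j\cdots B_{m-1}z_{2m-1}}.$$ Then, up to sign, $$\iota_{V_1}\cdots\iota_{V_m}\Omega_X^{(j)}=\pm\,d\log\frac{x_0^2}{B_m}\wedge d\log\frac{A_2}{B_m}\wedge\cdots\wedge d\log\frac{A_{j-1}}{B_m}\wedge d\log\frac{B_j}{B_m}\wedge\cdots\wedge d\log\frac{B_{m-1}}{B_m}.$$ In particular, for $\Omega_X^{\rm Sch}:=\Omega_X^{(m)}=\frac{dz_0dz_1\cdots dz_{2m-2}}{z_0A_2\cdots A_{m-1}z_{2m-1}}$ and $\Omega_X^{\rm Rie}:=\Omega_X^{(2)}=\frac{dz_0dz_1\cdots dz_{2m-2}}{z_0B_2\cdots B_{m-1}z_{2m-1}}$, $$\iota_{V_1}\cdots\iota_{V_m}\Omega_X^{\rm Sch}=\pm\,d\log\frac{x_0^2}{A_m}\wedge d\log\frac{A_2}{A_m}\wedge\cdots\wedge d\log\frac{A_{m-1}}{A_m},$$ $$\iota_{V_1}\cdots\iota_{V_m}\Omega_X^{\rm Rie}=\pm\,d\log\frac{x_0^2}{B_m}\wedge d\log\frac{B_2}{B_m}\wedge\cdots\wedge d\log\frac{B_{m-1}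}{B_m}.$$
   Context: Notation: $A_i=z_{2i-1}z_{2i}$ for $1\le i\le m$ in inhomogeneous coordinates (with $z_{2m}=1$), or $A_i=x_{2i-1}x_{2i}$ in homogeneous coordinates; $B_i=\sum_{l=i}^mA_l$ for $2\le i\le m$, so $B_m=A_m$. On $x_{2m}\ne0$ the quadric is $z_0^2+z_1z_2+\cdots+z_{2m-3}z_{2m-2}+z_{2m-1}=0$, with coordinates $(z_0,z_1,\dots,z_{2m-2})$. The torus $T^m$ acts by $(t_1,\dots,t_m)\cdot[x_0:x_1:\cdots:x_{2m}]=[x_0:t_1x_1:t_1^{-1}x_2:\cdots:t_mx_{2m-1}:t_m^{-1}x_{2m}]$. With $\theta_k$ the weight of $t_k$, the weights on $z_{2i-1},z_{2i}$ are $\theta_i+\theta_m$, $-\theta_i+\theta_m$ for $1\le i\le m-1$, and the weight on $z_0$ is $\theta_m$. $V_1,\dots,V_m$ are the vector fields corresponding to $\theta_1,\dots,\theta_m$, with contraction operators $$\iota_{V_i}=z_{2i-1}\iota_{z_{2i-1}}-z_{2i}\iota_{z_{2i}}\ (1\le i\le m-1),\qquad\iota_{V_m}=\sum_{i=0}^{2m-2}z_i\iota_{z_i},$$ where $\iota_y$ denotes contraction (on the left) with the holomorphic vector field $\partial/\partial y$. *)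

(* Defs.v *)
From HB Require Import structures.
From mathcomp Require Import all_boot all_order all_algebra.
From mathcomp Require Import generic_quotient fraction mpoly.
From mathcomp Require Import zify ring.
Set Implicit Arguments.
Unset Strict Implicit.
Unset Printing Implicit Defensive.
Import GRing.Theory.
Local Open Scope ring_scope.
Local Open Scope quotient_scope.

Section RationalForms.
Variables (k : fieldType) (n : nat).

(* The function field of affine n-space over k. *)
Local Notation ratfun := {fraction {mpoly k[n]}}.

(* Rational functions are a quotient of pairs (p, q), so the partial derivative
   is given by the quotient rule on a representative; [pderiv_frac] below shows
   that the choice of the representative is irrelevant. *)
Definition pderiv (i : 'I_n) (f : ratfun) : ratfun :=
  let p := \n_(repr f) in let q := \d_(repr f) in
  tofrac (p^`M(i) * q - p * q^`M(i)) / tofrac q ^+ 2.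

(* Rational differential forms of all degrees: w S is the coefficient of
   dz_{i_1} ... dz_{i_r}, where i_1 < ... < i_r are the elements of S. *)
Definition form := {ffun {set 'I_n} -> ratfun}.

Definition form_one : form := [ffun S => (S == set0)%:R].

Definition dcoord (i : 'I_n) : form := [ffun S => (S == [set i])%:R].

Definition scalef (c : ratfun) (w : form) : form := [ffun S => c * w S].

(* Number of transpositions sorting the concatenation of A and B, each listed
   increasingly. *)
Definition inversions (A B : {set 'I_n}) : nat :=
  #|[set ab in setX A B | (ab.2 < ab.1)%N]|.

Definition wedge (u v : form) : form :=
  [ffun S : {set 'I_n} =>
     \sum_(A in powerset S) (-1) ^+ inversions A (S :\: A) * (u A * v (S :\: A))].

Definition wedges (s : seq form) : form := foldr wedge form_one s.

Definition ext_d (f : ratfun) : form := \sum_(i < n) scalef (pderiv i f) (dcoord i).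

Definition dlog (f : ratfun) : form := scalef f^-1 (ext_d f).

(* Left contraction with d/dz_i: it sends dz_i ^ dz_S to dz_S if i is not in S,
   and kills dz_S. *)
Definition contract_coord (i : 'I_n) (w : form) : form :=
  [ffun S : {set 'I_n} =>
     if i \in S then 0
     else (-1) ^+ #|[set s in S | (s < i)%N]| * w (i |: S)].

(* Left contraction with the vector field \sum_i V_i d/dz_i. *)
Definition contract (V : 'I_n -> ratfun) (w : form) : form :=
  \sum_(i < n) scalef (V i) (contract_coord i w).

End RationalForms.

Section QuadricExpressions.
Variables (S : comNzRingType) (m : nat) (x : nat -> S).

Definition Aexpr (i : nat) : S := x i.*2.-1 * x i.*2.

Definition Bexpr (i : nat) : S := \sum_(i <= l < m.+1) Aexpr l.

Definition quadric : S := x 0%N ^+ 2 + \sum_(1 <= i < m.+1) Aexpr i.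

End QuadricExpressions.

Section Chart.
Variables (k : fieldType) (m : nat).

(* This is 2m - 1 for m >= 1, written as a successor. *)
Definition dimQ : nat := m.-1.*2.+1.

Definition affine_coord (i : nat) : {fraction {mpoly k[dimQ]}} := tofrac 'X_(inord i : 'I_dimQ).

(* The functions z_i = x_i / x_{2m}, 0 <= i <= 2m, on the chart x_{2m} != 0 of
   the quadric, in terms of its coordinates z_0, ..., z_{2m-2}. *)
Definition z (i : nat) : {fraction {mpoly k[dimQ]}} :=
  if (i < dimQ)%N then affine_coord i
  else if i == dimQ then
    - (affine_coord 0 ^+ 2 + \sum_(1 <= l < m) Aexpr affine_coord l)
  else 1.

Lemma z_affine (i : nat) : (i < dimQ)%N -> z i = affine_coord i.
Proof. by rewrite /z => ->. Qed.

Lemma z_dimQ :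
  z dimQ = - (affine_coord 0 ^+ 2 + \sum_(1 <= l < m) Aexpr affine_coord l).
Proof. by rewrite /z ltnn eqxx. Qed.

Lemma z_last : z dimQ.+1 = 1.
Proof. by rewrite /z ltnNge leqnSn /= gtn_eqF. Qed.

Definition hcoord (i : nat) : {mpoly k[m.*2.+1]} := 'X_(inord i : 'I_(m.*2.+1)).

(* Restriction of a polynomial in x_0, ..., x_{2m} along
   (z_0, ..., z_{2m-2}) |-> [z_0 : ... : z_{2m-1} : 1]. *)
Definition restrict (p : {mpoly k[m.*2.+1]}) : {fraction {mpoly k[dimQ]}} :=
  mmap (@tofrac _ \o @mpolyC dimQ k) (fun i : 'I_(m.*2.+1) => z i) p.

Lemma restrict_hcoord (i : nat) : (i <= m.*2)%N -> restrict (hcoord i) = z i.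
Proof. by move=> im; rewrite /restrict /hcoord mmapX mmap1U inordK. Qed.

(* The rational function P/Q on the quadric, for P and Q homogeneous of the
   same degree, read in the chart. *)
Definition hratio (P Q : {mpoly k[m.*2.+1]}) : {fraction {mpoly k[dimQ]}} :=
  restrict P / restrict Q.

(* t_i multiplies x_{2i-1} by t_i and x_{2i} by t_i^-1, so for i < m it generates
   z_{2i-1} d/dz_{2i-1} - z_{2i} d/dz_{2i}; t_m scales x_{2m}^-1 by t_m and hence
   generates the Euler field \sum_l z_l d/dz_l on the chart. *)
Definition torus_field (i : nat) (l : 'I_dimQ) : {fraction {mpoly k[dimQ]}} :=
  if i == m then z l
  else if l == i.*2.-1 :> nat then z l
  else if l == i.*2 :> nat then - z l
  else 0.

Definition contract_torus (w : form k dimQ) : form k dimQ :=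
  foldr (fun i => contract (torus_field i)) w (index_iota 1 m.+1).

Definition volume_form : form k dimQ :=
  wedges [seq ext_d (z i) | i <- index_iota 0 dimQ].

Definition Omega (j : nat) : form k dimQ :=
  scalef
    (z 0 * \prod_(2 <= i < j) Aexpr z i * \prod_(j <= i < m) Bexpr m z i
       * z m.*2.-1)^-1
    volume_form.

Definition Omega_Sch : form k dimQ := Omega m.

Definition Omega_Rie : form k dimQ := Omega 2.

Lemma Omega_SchE :
  Omega_Sch =
  scalef (z 0 * \prod_(2 <= i < m) Aexpr z i * z m.*2.-1)^-1 volume_form.
Proof. by rewrite /Omega_Sch /Omega [\prod_(m <= i < m) _]big_geq // mulr1. Qed.

Lemma Omega_RieE :
  Omega_Rie =
  scalef (z 0 * \prod_(2 <= i < m) Bexpr m z i * z m.*2.-1)^-1 volume_form.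
Proof. by rewrite /Omega_Rie /Omega [\prod_(2 <= i < 2) _]big_geq // mulr1. Qed.

End Chart.

Definition eq_up_to_sign (k : fieldType) (n : nat) (u v : form k n) : Prop :=
  u = v \/ u = - v.

Lemma quotient_rule_swap (S : comNzRingType) (p q a b p' q' a' b' : S) :
  p * b = a * q -> p' * b + p * b' = a' * q + a * q' ->
  (a' * b - a * b') * q ^+ 2 = (p' * q - p * q') * b ^+ 2.
Proof.
move=> e de.
have -> : (a' * b - a * b') * q ^+ 2 = b * q * (a' * q) - (a * q) * b' * q.
  by ring.
have -> : a' * q = p' * b + p * b' - a * q' by rewrite de addrK.
have -> : b * q * (p' * b + p * b' - a * q') =
  b * q * (p' * b + p * b') - b * (a * q) * q' by ring.
by rewrite -e; ring.
Qed.

Lemma cross_mul (F : fieldType) (p q a b : F) :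
  q != 0 -> p / q * b = a -> p * b = a * q.
Proof. by move=> q0 <-; rewrite mulrAC divfK. Qed.

Lemma eq_frac (F : fieldType) (u v q b : F) :
  b != 0 -> q != 0 -> u * q ^+ 2 = v * b ^+ 2 -> u / b ^+ 2 = v / q ^+ 2.
Proof.
by move=> b0 q0 e; apply/eqP; rewrite eqr_div ?expf_neq0 //; apply/eqP.
Qed.

Lemma tofrac_inj (D : idomainType) : injective (@tofrac D).
Proof. by move=> p q /eqP; rewrite tofrac_eq => /eqP. Qed.

Lemma reprE (D : idomainType) (f : {fraction D}) :
  f * tofrac \d_(repr f) = tofrac \n_(repr f).
Proof.
rewrite -{1}[f]reprK; move: (repr f) => r.
unlock tofrac; rewrite -[LHS]FracField.pi_mul.
apply/eqmodP; rewrite /= FracField.equivfE /FracField.mulf.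
by rewrite !numden_Ratio ?oner_neq0 ?mulr1 ?mulf_neq0 ?denom_ratioP // mulrC.
Qed.

Lemma pderiv_frac (k : fieldType) (n : nat) (i : 'I_n) (p q : {mpoly k[n]}) :
  q != 0 ->
  pderiv i (tofrac p / tofrac q) =
  tofrac (p^`M(i) * q - p * q^`M(i)) / tofrac q ^+ 2.
Proof.
move=> q0; rewrite /pderiv.
have q0' : tofrac q != 0 by rewrite tofrac_eq0.
move: (reprE (tofrac p / tofrac q)) (denom_ratioP (repr (tofrac p / tofrac q))).
move: (\n_(repr _)) (\d_(repr _)) => a b fb b0.
have b0' : tofrac b != 0 by rewrite tofrac_eq0.
have e : p * b = a * q.
  apply: (@tofrac_inj {mpoly k[n]}).
  rewrite (tofracM p b) (tofracM a q).
  exact: cross_mul q0' fb.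
have de : p^`M(i) * b + p * b^`M(i) = a^`M(i) * q + a * q^`M(i).
  by rewrite -!mderivM e.
apply: (eq_frac b0' q0').
rewrite -(tofracXn 2 q) -(tofracXn 2 b).
rewrite -(tofracM _ (q ^+ 2)) -(tofracM _ (b ^+ 2)).
by congr (tofrac _); apply: quotient_rule_swap e de.
Qed.

Lemma quadric_morph (S S' : comNzRingType) (f : {rmorphism S -> S'}) (m : nat)
    (x : nat -> S) (y : nat -> S') :
  (forall i, (i <= m.*2)%N -> f (x i) = y i) ->
  f (quadric m x) = quadric m y.
Proof.
move=> fxy; rewrite /quadric rmorphD rmorphXn /= fxy //; congr (_ + _).
rewrite rmorph_sum /= big_nat [RHS]big_nat; apply: eq_bigr => i /andP[i0 im].
by rewrite /Aexpr rmorphM /= !fxy //; lia.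
Qed.

Lemma quadric_chart (k : fieldType) (m : nat) :
  (0 < m)%N -> restrict (quadric m (hcoord k m)) = 0.
Proof.
case: m => // m _; apply: etrans (quadric_morph (@restrict_hcoord k m.+1)) _.
rewrite /quadric big_nat_recr //= {2}/Aexpr.
have -> : z k m.+1 m.+1.*2.-1 = z k m.+1 (dimQ m.+1) by [].
have -> : z k m.+1 m.+1.*2 = 1 by exact: z_last.
rewrite mulr1 z_dimQ z_affine // addrA.
have -> : \sum_(1 <= i < m.+1) Aexpr (z k m.+1) i =
    \sum_(1 <= i < m.+1) Aexpr (affine_coord k m.+1) i.
  rewrite big_nat [RHS]big_nat; apply: eq_bigr => i /andP[i0 im].
  by rewrite /Aexpr !z_affine // /dimQ; lia.
exact: subrr.
Qed.

(* Main.v *)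
Require Import Defs.
From mathcomp Require Import all_boot all_order all_algebra.
From mathcomp Require Import fraction mpoly.
From mathcomp Require Import reals.
From mathcomp Require Import complex.
From mathcomp Require Import zify ring.
Set Implicit Arguments.
Unset Strict Implicit.
Unset Printing Implicit Defensive.
Import GRing.Theory.
Local Open Scope ring_scope.

(** Put beta_l = dlog (z_{2l-1} / z_0) for l < m and beta_m = dlog z_0, so that
    beta_l(V_i) is the Kronecker delta.  The right-hand side eta is a product of
    forms dlog (f / B_m) with f and B_m of equal torus weight, hence is killed by
    every contraction, so that contracting beta_m ^ ... ^ beta_1 ^ eta with
    V_m, ..., V_1 gives back eta.  It remains to see that this product is
    +- Omega.  Up to scalars it is the product of the dz_0, dz_{2l-1}, dA_i
    (2 <= i < j), dB_i (j <= i <= m); reducing each factor modulo the previous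
    ones, dA_i becomes z_{2i-1} dz_{2i}, the equation of the quadric in the form
    B_j = - (z_0^2 + A_1 + ... + A_{j-1}) turns dB_j into - z_1 dz_2, and
    B_{i+1} = B_i - A_i turns dB_{i+1} into - z_{2i-1} dz_{2i}. *)

(** * Exterior multiplication and contraction by coordinates *)

Section Forms.
Variables (k : fieldType) (n : nat).
Local Notation K := {fraction {mpoly k[n]}}.
Local Notation form := (Defs.form k n).
Implicit Types (a b c : K) (u v w : form) (i j : 'I_n) (S : {set 'I_n}).

Lemma scalefDr c u v : scalef c (u + v) = scalef c u + scalef c v.
Proof. by apply/ffunP => S; rewrite !ffunE mulrDr. Qed.

Lemma scalefDl a b u : scalef (a + b) u = scalef a u + scalef b u.
Proof. by apply/ffunP => S; rewrite !ffunE mulrDl. Qed.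

Lemma scalefA a b u : scalef a (scalef b u) = scalef (a * b) u.
Proof. by apply/ffunP => S; rewrite !ffunE mulrA. Qed.

Lemma scale1f u : scalef 1 u = u.
Proof. by apply/ffunP => S; rewrite !ffunE mul1r. Qed.

Lemma scale0f u : scalef 0 u = 0.
Proof. by apply/ffunP => S; rewrite !ffunE mul0r. Qed.

Lemma scalef0 c : scalef c (0 : form) = 0.
Proof. by apply/ffunP => S; rewrite !ffunE mulr0. Qed.

Lemma scaleNf c u : scalef (- c) u = - scalef c u.
Proof. by apply/ffunP => S; rewrite !ffunE mulNr. Qed.

Lemma scalefN c u : scalef c (- u) = - scalef c u.
Proof. by apply/ffunP => S; rewrite !ffunE mulrN. Qed.

Lemma scalef_sum (I : Type) (r : seq I) c (F : I -> form) :
  scalef c (\sum_(i <- r) F i) = \sum_(i <- r) scalef c (F i).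
Proof. exact: (big_morph _ (scalefDr c) (scalef0 c)). Qed.

Lemma wedgeDl u v w : wedge (u + v) w = wedge u w + wedge v w.
Proof.
apply/ffunP => S; rewrite !ffunE -big_split; apply: eq_bigr => A _ /=.
by rewrite !ffunE mulrDl mulrDr.
Qed.

Lemma wedgeDr u v w : wedge u (v + w) = wedge u v + wedge u w.
Proof.
apply/ffunP => S; rewrite !ffunE -big_split; apply: eq_bigr => A _ /=.
by rewrite !ffunE !mulrDr.
Qed.

Lemma wedgeZl c u w : wedge (scalef c u) w = scalef c (wedge u w).
Proof.
apply/ffunP => S; rewrite !ffunE mulr_sumr; apply: eq_bigr => A _.
by rewrite !ffunE -mulrA mulrCA.
Qed.

Lemma wedgeZr c u w : wedge u (scalef c w) = scalef c (wedge u w).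
Proof.
apply/ffunP => S; rewrite !ffunE mulr_sumr; apply: eq_bigr => A _.
by rewrite !ffunE [u A * _]mulrCA [LHS]mulrCA.
Qed.

Lemma wedge0r u : wedge u 0 = 0.
Proof. by rewrite -{1}(scale0f 0) wedgeZr scale0f. Qed.

Lemma wedge0l u : wedge 0 u = 0.
Proof. by rewrite -{1}(scale0f 0) wedgeZl scale0f. Qed.

Lemma wedgeNr u w : wedge u (- w) = - wedge u w.
Proof. by rewrite -[w in LHS]scale1f -scaleNf wedgeZr scaleNf scale1f. Qed.

Lemma wedgeNl u w : wedge (- u) w = - wedge u w.
Proof. by rewrite -[u in LHS]scale1f -scaleNf wedgeZl scaleNf scale1f. Qed.

Lemma wedge_suml (I : Type) (r : seq I) (F : I -> form) w :
  wedge (\sum_(i <- r) F i) w = \sum_(i <- r) wedge (F i) w.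
Proof.
by apply: (big_morph (fun u => wedge u w)) => [u v|]; rewrite ?wedgeDl ?wedge0l.
Qed.

(** The sign of moving dz_i past the smaller coordinates of S; it is common to left multiplication
    by dz_i and to contraction with d/dz_i. *)
Definition pos_sign i S : K := (-1) ^+ #|[set s in S | (s < i)%N]|.

Lemma pos_signD1 i j S : i \in S ->
  pos_sign j S = (-1) ^+ (i < j)%N * pos_sign j (S :\ i).
Proof.
move=> iS; rewrite /pos_sign -exprD; congr (_ ^+ _).
rewrite (cardsD1 i) inE iS /=; congr (_ + #|pred_of_set _|)%N.
by apply/setP => s; rewrite !inE andbA.
Qed.

Lemma pos_sign_sqr i S : pos_sign i S * pos_sign i S = 1.
Proof. by rewrite -expr2 sqrr_sign. Qed.

(** Only A = {i} contributes to the sum defining [wedge], and its inversions with S minus i are the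
    elements of S below i. Later products are handled as iterated left multiplications, so they
    reduce to this formula. *)
Lemma wedge_dcoordE i w S :
  wedge (dcoord k i) w S = if i \in S then pos_sign i S * w (S :\ i) else 0.
Proof.
rewrite ffunE; have [iS|iS] := boolP (i \in S); last first.
  apply: big1 => A; rewrite powersetE ffunE => AS.
  case: eqP => [Ai|_]; last by rewrite mul0r mulr0.
  by move: AS iS; rewrite Ai sub1set => ->.
rewrite (bigD1 [set i]) ?powersetE ?sub1set //= big1 ?addr0.
  rewrite ffunE eqxx mul1r; congr (_ ^+ _ * _).
  rewrite /inversions -[RHS](card_imset _ (f := pair i)) => [|? ? []//].
  apply: eq_card => -[a b]; rewrite !inE /=.
  apply/andP/imsetP => [[/andP[/eqP -> /andP[bi bS]] lt]|[b']].
    by exists b; rewrite // inE bS.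
  rewrite inE => /andP[b'S lt] [-> ->]; split=> //.
  by rewrite eqxx b'S andbT; apply: contraTneq lt => ->; rewrite ltnn.
by move=> A /andP[_ /negPf Ai]; rewrite ffunE Ai mul0r mulr0.
Qed.

Lemma wedge_dcoord_anti i j w :
  wedge (dcoord k i) (wedge (dcoord k j) w) =
  - wedge (dcoord k j) (wedge (dcoord k i) w).
Proof.
have [->|ij] := eqVneq i j.
  apply/ffunP => S; rewrite [RHS]ffunE !wedge_dcoordE.
  by case: ifP => _; rewrite ?setD11 ?mulr0 ?oppr0.
apply/ffunP => S; rewrite [RHS]ffunE !wedge_dcoordE !in_setD1 ij eq_sym ij /=.
case: ifP => iS; case: ifP => jS; rewrite ?mulr0 ?oppr0 //.
rewrite (pos_signD1 i jS) (pos_signD1 j iS) setDDl setUC -setDDl.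
(* For distinct i and j exactly one of i < j and j < i holds; this is the only difference between
   the two signs. *)
have : (-1) ^+ (i < j)%N = - (-1) ^+ (j < i)%N :> K.
  move: ij; rewrite -val_eqE neq_ltn.
  by case: ltngtP => //= _ _; rewrite ?opprK.
move=> ->; rewrite !mulNr opprK.
set s := pos_sign j _; set t := pos_sign i _; set e := _ ^+ _.
by rewrite mulrA mulrA; congr (_ * _); rewrite -!mulrA; congr (_ * _); apply: mulrC.
Qed.

Lemma contract_coordE i w S :
  contract_coord i w S = if i \in S then 0 else pos_sign i S * w (i |: S).
Proof. by rewrite ffunE. Qed.

(** For i = j exactly one of the two terms on the right survives, according to whether i lies in S.
    For distinct indices, inserting i and removing j commute up to the sign comparing i with j. *)
Lemma contract_coord_dcoord i j w :
  contract_coord i (wedge (dcoord k j) w) =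
  scalef (i == j)%:R w - wedge (dcoord k j) (contract_coord i w).
Proof.
apply/ffunP => S; rewrite [RHS]ffunE [X in _ = X + _]ffunE [X in _ = _ + X]ffunE.
rewrite contract_coordE !wedge_dcoordE !contract_coordE.
rewrite in_setD1 in_setU1; have [->|ij] := eqVneq j i.
  rewrite /= mul1r; case: ifP => iS.
    rewrite setD1K // mulrA (pos_signD1 i iS) ltnn mul1r pos_sign_sqr mul1r.
    by rewrite subrr.
  rewrite setU1K ?iS // mulrA (@pos_signD1 i i (i |: S)) ?setU11 //.
  by rewrite ltnn mul1r setU1K ?iS // pos_sign_sqr mul1r oppr0 addr0.
rewrite /= mul0r add0r.
case: ifP => iS; case: ifP => jS; rewrite ?mulr0 ?oppr0 //.
have niS : i \notin S by rewrite iS.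
rewrite (pos_signD1 i jS) (@pos_signD1 i j (i |: S)) ?setU11 // setU1K //.
have -> : (i |: S) :\ j = i |: (S :\ j).
  apply/setP => s; rewrite !inE; case: (eqVneq s i) => //= ->.
  by rewrite eq_sym ij.
have : (-1) ^+ (i < j)%N = - (-1) ^+ (j < i)%N :> K.
  move: ij; rewrite -val_eqE neq_ltn.
  by case: ltngtP => //= _ _; rewrite ?opprK.
move=> ->; rewrite !mulNr !mulrN; congr (- _).
have : (-1) ^+ (j < i)%N * (-1) ^+ (j < i)%N = 1 :> K.
  by rewrite -expr2 sqrr_sign.
set s := pos_sign j _; set t := pos_sign i _; set e := _ ^+ _ => ee.
rewrite [e * s]mulrC [e * t]mulrC -[t * e * _]mulrA ![e * (_ * _)]mulrA.
by rewrite [e * s]mulrC -[s * e * e]mulrA ee mulr1 mulrCA.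
Qed.

End Forms.

(** * Products of one-forms *)

Section OneForms.
Variables (k : fieldType) (n : nat).
Local Notation K := {fraction {mpoly k[n]}}.
Local Notation form := (Defs.form k n).
Implicit Types (c : K) (a b u w : form) (i j : 'I_n) (S : {set 'I_n}).
Implicit Types (V : 'I_n -> K) (l : seq form).

(** Explicit coefficients let identities proved for [dcoord] extend by linearity. *)
Definition one_form a : Prop :=
  exists c : 'I_n -> K, a = \sum_(i < n) scalef (c i) (dcoord k i).

Lemma one_form_ext_d (f : K) : one_form (ext_d f).
Proof. by exists (fun i => pderiv i f). Qed.

Lemma one_formZ c a : one_form a -> one_form (scalef c a).
Proof.
move=> [d ->]; exists (fun i => c * d i); rewrite scalef_sum.
by apply: eq_bigr => i _; rewrite scalefA.
Qed.

Lemma one_formD a b : one_form a -> one_form b -> one_form (a + b).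
Proof.
move=> [d ->] [e ->]; exists (fun i => d i + e i); rewrite -big_split.
by apply: eq_bigr => i _; rewrite scalefDl.
Qed.

Lemma one_form_dcoord i : one_form (dcoord k i).
Proof.
exists (fun j => (j == i)%:R); rewrite (bigD1 i) //= eqxx scale1f big1 ?addr0 //.
by move=> j /negPf ->; rewrite scale0f.
Qed.

Lemma one_form_dlog (f : K) : one_form (dlog f).
Proof. exact/one_formZ/one_form_ext_d. Qed.

Lemma wedge_one_formE (d : 'I_n -> K) w :
  wedge (\sum_(i < n) scalef (d i) (dcoord k i)) w =
  \sum_(i < n) scalef (d i) (wedge (dcoord k i) w).
Proof. by rewrite wedge_suml; apply: eq_bigr => i _; rewrite wedgeZl. Qed.

Lemma wedge_sumr (I : Type) (r : seq I) a (F : I -> form) :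
  wedge a (\sum_(i <- r) F i) = \sum_(i <- r) wedge a (F i).
Proof.
by apply: (big_morph (fun u => wedge a u)) => [u v|]; rewrite ?wedgeDr ?wedge0r.
Qed.

Lemma wedge_one_form_anti a b w : one_form a -> one_form b ->
  wedge a (wedge b w) = - wedge b (wedge a w).
Proof.
move=> [d ->] [e ->].
have expand (f g : 'I_n -> K) :
  wedge (\sum_(i < n) scalef (f i) (dcoord k i))
    (wedge (\sum_(i < n) scalef (g i) (dcoord k i)) w) =
  \sum_(i < n) \sum_(j < n) scalef (f i * g j)
    (wedge (dcoord k i) (wedge (dcoord k j) w)).
  rewrite [LHS]wedge_one_formE; apply: eq_bigr => i _.
  rewrite wedge_one_formE wedge_sumr scalef_sum; apply: eq_bigr => j _.
  by rewrite wedgeZr scalefA.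
rewrite !expand exchange_big -sumrN; apply: eq_bigr => i _ /=.
rewrite -sumrN; apply: eq_bigr => j _.
by rewrite mulrC wedge_dcoord_anti scalefN.
Qed.

(** Anticommutation alone would only show that twice the square is zero, and k may have
    characteristic 2. Hence the induction on the number of terms: cross terms cancel in pairs, and
    the squares of the dz_i vanish because i is not in S minus i. *)
Lemma wedge_one_form_sqr a w : one_form a -> wedge a (wedge a w) = 0.
Proof.
move=> [d ->]; elim: (index_enum _) => [|i r IHr].
  by rewrite big_nil wedge0l.
have one_i := one_formZ (d i) (one_form_dcoord i).
have one_r : one_form (\sum_(j <- r) scalef (d j) (dcoord k j)).
  elim: r {IHr} => [|j r IHr]; rewrite ?big_nil ?big_cons.
    by rewrite -(scale0f (dcoord k i)); apply/one_formZ/one_form_dcoord.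
  by apply: one_formD IHr; apply/one_formZ/one_form_dcoord.
rewrite big_cons !wedgeDl !wedgeDr IHr addr0.
rewrite [X in _ + X]wedge_one_form_anti // addrK.
rewrite wedgeZl wedgeZl wedgeZr.
suff -> : wedge (dcoord k i) (wedge (dcoord k i) w) = 0 by rewrite !scalef0.
by apply/ffunP => S; rewrite !wedge_dcoordE setD11 !mulr0 [RHS]ffunE if_same.
Qed.

(** * Contraction with a vector field as an antiderivation *)

Lemma contract_coordD i u w :
  contract_coord i (u + w) = contract_coord i u + contract_coord i w.
Proof.
apply/ffunP => S; rewrite [RHS]ffunE !contract_coordE ffunE.
by case: ifP; rewrite ?addr0 // mulrDr.
Qed.

Lemma contract_coordZ i c w :
  contract_coord i (scalef c w) = scalef c (contract_coord i w).
Proof.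
apply/ffunP => S; rewrite [RHS]ffunE !contract_coordE ffunE.
by case: ifP; rewrite ?mulr0 // mulrCA.
Qed.

Lemma contractD V u w : contract V (u + w) = contract V u + contract V w.
Proof.
rewrite /contract -big_split; apply: eq_bigr => i _ /=.
by rewrite contract_coordD scalefDr.
Qed.

Lemma contractZ V c w : contract V (scalef c w) = scalef c (contract V w).
Proof.
rewrite /contract scalef_sum; apply: eq_bigr => i _.
by rewrite contract_coordZ !scalefA mulrC.
Qed.

Lemma contract0 V : contract V 0 = 0.
Proof. by rewrite -{1}(scale0f 0) contractZ scale0f. Qed.

Lemma contractN V w : contract V (- w) = - contract V w.
Proof. by rewrite -{1}(scale1f w) -scaleNf contractZ scaleNf scale1f. Qed.

Lemma contract_form_one V : contract V (form_one k n) = 0.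
Proof.
rewrite /contract big1 // => i _; apply/ffunP => S.
rewrite 2!ffunE [RHS]ffunE; case: ifP; rewrite ?mulr0 // => iS.
by rewrite ffunE -subset0 subUset sub1set in_set0 !mulr0.
Qed.

(** A contracted one-form has degree 0, so its coefficient at [set0] is the value of the one-form on
    V; this is how a(V) is written from here on. *)
Lemma contract_dcoord V j : contract V (dcoord k j) set0 = V j.
Proof.
rewrite /contract sum_ffunE (bigD1 j) //= big1 => [|i ij].
  rewrite addr0 2!ffunE in_set0 setU0 ffunE eqxx mulr1.
  rewrite (_ : [set s in set0 | _] = set0) ?cards0 ?mulr1 //.
  by apply/setP => s; rewrite !inE.
rewrite 2!ffunE in_set0 setU0 ffunE.
case: eqP => [/setP/(_ i)|_]; last by rewrite !mulr0.
by rewrite !inE eqxx (negPf ij).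
Qed.

(** Both sides are linear in a, so the rule follows from the coordinate case
    [contract_coord_dcoord]. *)
Lemma contract_wedge V a w : one_form a ->
  contract V (wedge a w) =
  scalef (contract V a set0) w - wedge a (contract V w).
Proof.
have base j : contract V (wedge (dcoord k j) w) =
    scalef (V j) w - wedge (dcoord k j) (contract V w).
  rewrite /contract wedge_sumr.
  rewrite (eq_bigr (fun i => scalef (V i) (scalef (i == j)%:R w) +
    - wedge (dcoord k j) (scalef (V i) (contract_coord i w)))); last first.
    by move=> i _; rewrite contract_coord_dcoord scalefDr scalefN wedgeZr.
  rewrite big_split /= sumrN; congr (_ - _).
  rewrite (bigD1 j) //= eqxx scale1f big1 ?addr0 // => i /negPf ->.
  by rewrite scale0f scalef0.
move=> [d ->]; elim: (index_enum _) => [|i r IHr].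
  by rewrite !big_nil !wedge0l !contract0 ffunE scale0f subr0.
rewrite !big_cons !wedgeDl !contractD IHr wedgeZl !contractZ base.
rewrite !ffunE contract_dcoord scalefDl scalefDr scalefA scalefN wedgeZl.
by rewrite opprD addrACA.
Qed.

(** Unlike [wedges], the product ends in an arbitrary form w, so factors can be simplified modulo
    what w kills. *)
Definition wedgel l w : form := foldr (@wedge k n) w l.

Lemma wedgel_cat l1 l2 w : wedgel (l1 ++ l2) w = wedgel l1 (wedgel l2 w).
Proof. exact: foldr_cat. Qed.

Lemma wedgelZ l c w : wedgel l (scalef c w) = scalef c (wedgel l w).
Proof. by elim: l => //= a l ->; rewrite wedgeZr. Qed.

Lemma contract_wedgel_eq0 V l w :
  (forall a, a \in l -> one_form a /\ contract V a set0 = 0) ->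
  contract V w = 0 -> contract V (wedgel l w) = 0.
Proof.
move=> + Vw; elim: l => //= a l IHl al.
have [one_a Va] := al a (mem_head _ _).
rewrite contract_wedge // Va scale0f IHl ?wedge0r ?subr0 // => b bl.
by apply: al; rewrite inE bl orbT.
Qed.

(** The factor u anticommutes past the whole list at the cost of signs and then meets w. *)
Lemma wedge_wedgel_eq0 u l w : one_form u ->
  (forall a, a \in l -> one_form a) -> wedge u w = 0 ->
  wedge u (wedgel l w) = 0.
Proof.
move=> one_u + uw; elim: l => //= a l IHl al.
rewrite wedge_one_form_anti ?IHl ?wedge0r ?oppr0 //.
  by move=> b bl; apply: al; rewrite inE bl orbT.
exact/al/mem_head.
Qed.

Lemma wedge_wedgel_mem u l w : (forall a, a \in l -> one_form a) ->
  u \in l -> wedge u (wedgel l w) = 0.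
Proof.
move=> one_l ul; have one_u := one_l u ul; move: ul one_l.
elim: l => //= a l IHl; rewrite inE => /orP[/eqP <- _|ul one_l].
  exact: wedge_one_form_sqr.
rewrite wedge_one_form_anti ?IHl ?wedge0r ?oppr0 //.
  by move=> b bl; apply: one_l; rewrite inE bl orbT.
exact/one_l/mem_head.
Qed.

(** This is reduction modulo w: each error term u is killed by w, hence also by w multiplied by the
    remaining g's, so only the leading terms [scalef (c x) (g x)] survive. *)
Lemma wedgel_reduce (I : eqType) (s : seq I) (f g : I -> form) (c : I -> K) w :
  (forall x, one_form (g x)) ->
  (forall x, x \in s -> exists2 u, f x = scalef (c x) (g x) + u &
    one_form u /\ wedge u w = 0) ->
  wedgel [seq f x | x <- s] w =
  scalef (\prod_(x <- s) c x) (wedgel [seq g x | x <- s] w).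
Proof.
move=> one_g; elim: s => [|i s IHs] fg /=; first by rewrite big_nil scale1f.
rewrite IHs => [|j js]; last by apply: fg; rewrite inE js orbT.
have [u -> [one_u uw]] := fg i (mem_head _ _).
rewrite big_cons wedgeZr wedgeDl wedgeZl [wedge u _]wedge_wedgel_eq0 //.
  by rewrite addr0 scalefA mulrC.
by move=> a /mapP[j _ ->].
Qed.

(** * Equality up to sign and reordering of factors *)

Lemma eq_up_to_sign_trans u v w :
  eq_up_to_sign u v -> eq_up_to_sign v w -> eq_up_to_sign u w.
Proof.
by case=> -> [] ->; rewrite ?opprK; [left | right | right | left].
Qed.

Lemma eq_up_to_sign_sym u v : eq_up_to_sign u v -> eq_up_to_sign v u.
Proof. by case=> ->; rewrite /eq_up_to_sign ?opprK; [left | right]. Qed.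

Lemma eq_up_to_sign_wedge a u v :
  eq_up_to_sign u v -> eq_up_to_sign (wedge a u) (wedge a v).
Proof. by case=> ->; rewrite ?wedgeNr; [left | right]. Qed.

Lemma eq_up_to_sign_scalef c u v :
  eq_up_to_sign u v -> eq_up_to_sign (scalef c u) (scalef c v).
Proof. by case=> ->; rewrite ?scalefN; [left | right]. Qed.

Lemma wedgel_move a l1 l2 w : (forall b, b \in a :: l1 -> one_form b) ->
  eq_up_to_sign (wedgel (l1 ++ a :: l2) w) (wedge a (wedgel (l1 ++ l2) w)).
Proof.
elim: l1 => [|b l1 IHl] one_l; first by left.
have one_a := one_l a (mem_head _ _).
have one_b : one_form b by apply: one_l; rewrite !inE eqxx orbT.
apply: (eq_up_to_sign_trans (eq_up_to_sign_wedge b (IHl _))) => [c|] /=.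
  by rewrite inE => H; apply: one_l; rewrite !inE; case/orP: H => ->; rewrite ?orbT.
by right; rewrite wedge_one_form_anti.
Qed.

(** The head of the first list is located in the second and brought to the front by [wedgel_move];
    induction treats the rest. *)
Lemma wedgel_perm l1 l2 w : (forall a, a \in l1 -> one_form a) ->
  perm_eq l1 l2 -> eq_up_to_sign (wedgel l1 w) (wedgel l2 w).
Proof.
elim: l1 l2 => [|a l1 IHl] l2 one_l pl.
  by rewrite perm_sym in pl; rewrite (perm_nilP pl); left.
have al2 : a \in l2 by rewrite -(perm_mem pl) mem_head.
have one_l2 b : b \in l2 -> one_form b by rewrite -(perm_mem pl) => /one_l.
move: al2 pl one_l2; case/splitPr => p1 p2 pl one_l2.
have pl' : perm_eq l1 (p1 ++ p2).
  by rewrite -(perm_cons a) (perm_trans pl) // perm_catC /= perm_cons perm_catC.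
apply: (eq_up_to_sign_trans (eq_up_to_sign_wedge a (IHl _ _ pl'))).
  by move=> b bl; apply: one_l; rewrite inE bl orbT.
apply: eq_up_to_sign_sym; apply: wedgel_move => b.
by rewrite inE => H; apply: one_l2; rewrite mem_cat inE; case/orP: H => ->; rewrite ?orbT.
Qed.

End OneForms.

(** * Derivations of the function field *)

Section QuotientRules.
Variables (A : comNzRingType) (F : fieldType) (phi : {rmorphism A -> F}).
Variables (p q p' q' dp dq dp' dq' : A).
Hypotheses (q0 : phi q != 0) (q0' : phi q' != 0).

Lemma rmorph_addf :
  phi p / phi q + phi p' / phi q' = phi (p * q' + p' * q) / phi (q * q').
Proof. by rewrite rmorphD !rmorphM; field; rewrite q0 q0'. Qed.

Lemma rmorph_mulf :
  phi p / phi q * (phi p' / phi q') = phi (p * p') / phi (q * q').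
Proof. by rewrite !rmorphM mulf_div. Qed.

(** The letters dp, dq, dp', dq' are free elements standing for derivatives, and phi stands for
    [tofrac]; additivity of the quotient rule is then an identity of rational expressions that
    [field] decides. *)
Lemma quotient_ruleD :
  phi ((dp * q' + p * dq' + (dp' * q + p' * dq)) * (q * q') -
     (p * q' + p' * q) * (dq * q' + q * dq')) / phi (q * q') ^+ 2 =
  phi (dp * q - p * dq) / phi q ^+ 2 + phi (dp' * q' - p' * dq') / phi q' ^+ 2.
Proof.
by rewrite !(rmorphB, rmorphD, rmorphM); field; rewrite q0 q0'.
Qed.

Lemma quotient_ruleM :
  phi ((dp * p' + p * dp') * (q * q') - p * p' * (dq * q' + q * dq')) /
    phi (q * q') ^+ 2 =
  phi (dp * q - p * dq) / phi q ^+ 2 * (phi p' / phi q') +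
    phi p / phi q * (phi (dp' * q' - p' * dq') / phi q' ^+ 2).
Proof.
by rewrite !(rmorphB, rmorphD, rmorphM); field; rewrite q0 q0'.
Qed.

End QuotientRules.

Section Derivations.
Variables (k : fieldType) (n : nat).
Local Notation K := {fraction {mpoly k[n]}}.
Local Notation form := (Defs.form k n).
Implicit Types (f g : K) (c : K) (i : 'I_n) (V : 'I_n -> K).

Lemma fracP f : exists2 pq : {mpoly k[n]} * {mpoly k[n]},
  pq.2 != 0 & f = tofrac pq.1 / tofrac pq.2.
Proof.
exists (\n_(repr f), \d_(repr f)); first exact: denom_ratioP.
rewrite -reprE mulfK // tofrac_eq0; exact: denom_ratioP.
Qed.

Lemma pderivD i f g : pderiv i (f + g) = pderiv i f + pderiv i g.
Proof.
have [[p q] /= q0 ->] := fracP f; have [[p' q'] /= q0' ->] := fracP g.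
have tq : tofrac q != 0 by rewrite tofrac_eq0.
have tq' : tofrac q' != 0 by rewrite tofrac_eq0.
rewrite (rmorph_addf p p' tq tq') (pderiv_frac i (p * q' + p' * q)) ?mulf_neq0 //.
rewrite (pderiv_frac i p q0) (pderiv_frac i p' q0').
rewrite mderivD (mderivM _ p) (mderivM _ p') (mderivM _ q).
exact: (quotient_ruleD _ _ _ _ _ _ tq tq').
Qed.

Lemma pderivM i f g : pderiv i (f * g) = pderiv i f * g + f * pderiv i g.
Proof.
have [[p q] /= q0 ->] := fracP f; have [[p' q'] /= q0' ->] := fracP g.
have tq : tofrac q != 0 by rewrite tofrac_eq0.
have tq' : tofrac q' != 0 by rewrite tofrac_eq0.
rewrite (rmorph_mulf (@tofrac {mpoly k[n]}) p q p' q').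
rewrite (pderiv_frac i (p * p')) ?mulf_neq0 //.
rewrite (pderiv_frac i p q0) (pderiv_frac i p' q0').
rewrite (mderivM _ p) (mderivM _ q).
exact: (quotient_ruleM _ _ _ _ _ _ tq tq').
Qed.

Lemma pderiv_tofrac i (p : {mpoly k[n]}) : pderiv i (tofrac p) = tofrac p^`M(i).
Proof.
rewrite -[tofrac p]divr1 -tofrac1 pderiv_frac ?oner_neq0 //.
by rewrite mderivC mulr0 mulr1 subr0 tofrac1 expr1n divr1.
Qed.

Lemma ext_dD f g : ext_d (f + g) = ext_d f + ext_d g.
Proof.
rewrite /ext_d -big_split; apply: eq_bigr => i _ /=.
by rewrite pderivD scalefDl.
Qed.

Lemma ext_dM f g : ext_d (f * g) = scalef g (ext_d f) + scalef f (ext_d g).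
Proof.
rewrite /ext_d !scalef_sum -big_split; apply: eq_bigr => i _ /=.
by rewrite pderivM scalefDl !scalefA [g * _]mulrC.
Qed.

Lemma ext_d0 : ext_d (0 : K) = 0.
Proof. by apply: (addrI (ext_d (0 : K))); rewrite -ext_dD !addr0. Qed.

Lemma ext_dN f : ext_d (- f) = - ext_d f.
Proof. by apply: (addrI (ext_d f)); rewrite -ext_dD !subrr ext_d0. Qed.

Lemma ext_d_sum (I : Type) (r : seq I) (F : I -> K) :
  ext_d (\sum_(x <- r) F x) = \sum_(x <- r) ext_d (F x).
Proof. exact: (big_morph _ ext_dD ext_d0). Qed.

Lemma dlogM f g : f != 0 -> g != 0 -> dlog (f * g) = dlog f + dlog g.
Proof.
move=> f0 g0; rewrite /dlog ext_dM scalefDr !scalefA.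
rewrite invfM -mulrA (mulVf g0) mulr1.
by rewrite mulrAC (mulVf f0) mul1r.
Qed.

Lemma dlog_div f g : f != 0 -> g != 0 -> dlog (f / g) = dlog f - dlog g.
Proof.
move=> f0 g0; have fg0 := mulf_neq0 f0 (invr_neq0 g0).
have := dlogM fg0 g0; rewrite (divfK g0) => ->.
by rewrite addrK.
Qed.

Lemma ext_d_tofracX i : ext_d (tofrac ('X_i : {mpoly k[n]})) = dcoord k i.
Proof.
rewrite /ext_d (bigD1 i) //= big1 => [|j ji]; rewrite pderiv_tofrac mderivX mnm1E.
  rewrite eqxx scale1r (_ : (_ - _)%MM = 0%MM) ?mpolyX0 ?tofrac1 ?scale1f ?addr0 //.
  by apply/mnmP => j; rewrite mnmBE subnn mnmE.
by rewrite eq_sym (negPf ji) scale0r tofrac0 scale0f.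
Qed.

(** * Eigenfunctions of a vector field; the weight is the eigenvalue of the derivative along V *)

Definition has_weight V f c := contract V (ext_d f) set0 = c * f.

Lemma has_weightD V f g c :
  has_weight V f c -> has_weight V g c -> has_weight V (f + g) c.
Proof.
by rewrite /has_weight ext_dD contractD ffunE => -> ->; rewrite mulrDr.
Qed.

Lemma has_weightN V f c : has_weight V f c -> has_weight V (- f) c.
Proof. by rewrite /has_weight ext_dN contractN ffunE => ->; rewrite mulrN. Qed.

Lemma has_weightM V f g c c' :
  has_weight V f c -> has_weight V g c' -> has_weight V (f * g) (c + c').
Proof.
rewrite /has_weight ext_dM contractD !contractZ !ffunE => -> ->.
by rewrite mulrDl mulrCA [g * f]mulrC [f * (c' * g)]mulrCA.
Qed.

Lemma has_weight_sum V (I : eqType) (r : seq I) (F : I -> K) c :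
  (forall x, x \in r -> has_weight V (F x) c) ->
  has_weight V (\sum_(x <- r) F x) c.
Proof.
move=> rF; rewrite big_seq; apply: (big_ind (fun f => has_weight V f c)) => // [|f g].
  by rewrite /has_weight ext_d0 contract0 ffunE mulr0.
exact: has_weightD.
Qed.

Lemma contract_dlog_weight V f c :
  f != 0 -> has_weight V f c -> contract V (dlog f) set0 = c.
Proof. by move=> f0 Vf; rewrite contractZ ffunE Vf mulrC mulfK. Qed.

(** The value of [dlog f] on V is the logarithmic derivative of f along V, which is its weight.
    Equal weights therefore make the contraction vanish. *)
Lemma contract_dlog_div V f g c c' : f != 0 -> g != 0 ->
  has_weight V f c -> has_weight V g c' ->
  contract V (dlog (f / g)) set0 = c - c'.
Proof.
move=> f0 g0 Vf Vg.
rewrite (dlog_div f0 g0) contractD contractN ffunE [X in _ + X]ffunE.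
by rewrite (contract_dlog_weight f0 Vf) (contract_dlog_weight g0 Vg).
Qed.

End Derivations.

(** * The affine chart of the quadric *)

Lemma iota_rcons (a d : nat) : iota a d.+1 = rcons (iota a d) (a + d)%N.
Proof. by rewrite -addn1 iotaD cats1. Qed.

Section Chart.
Variables (k : fieldType) (m : nat).
Local Notation K := {fraction {mpoly k[dimQ m]}}.
Local Notation form := (Defs.form k (dimQ m)).
Local Notation z := (z k m).
Local Notation A := (Aexpr z).
Local Notation B := (Bexpr m z).
Implicit Types (i j l : nat).

Lemma restrict_Aexpr i : (i <= m)%N -> Defs.restrict (Aexpr (hcoord k m) i) = A i.
Proof.
move=> im; rewrite /Defs.restrict /Aexpr rmorphM /=.
by congr (_ * _); apply: restrict_hcoord; lia.
Qed.

Lemma restrict_Bexpr i : Defs.restrict (Bexpr m (hcoord k m) i) = B i.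
Proof.
rewrite /Defs.restrict /Bexpr rmorph_sum !big_nat; apply: eq_bigr => l /andP[_ lm].
exact: restrict_Aexpr.
Qed.

Lemma restrict_sqr0 : Defs.restrict (hcoord k m 0 ^+ 2) = z 0 ^+ 2.
Proof. by rewrite /Defs.restrict rmorphXn /= -restrict_hcoord. Qed.

Hypothesis hm : (2 <= m)%N.

(** Since z_{2m} = 1, the last factor z_{2m-1} in the denominator of [Omega] is A_m, that is B_m. *)
Lemma z_dimQ_Aexpr : z (dimQ m) = A m.
Proof.
rewrite /Aexpr; have -> : m.*2 = (dimQ m).+1 by rewrite /dimQ; lia.
by rewrite [(dimQ m).+1.-1]/= z_last mulr1.
Qed.

Lemma Bexpr_last : B m = A m.
Proof. by rewrite /Bexpr big_nat1. Qed.

Lemma Bexpr_recl i : (i <= m)%N -> B i = A i + B i.+1.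
Proof. by move=> im; rewrite /Bexpr big_ltn. Qed.

Lemma quadric_z : z 0 ^+ 2 + \sum_(1 <= l < m.+1) A l = 0.
Proof.
rewrite big_nat_recr ?(ltnW hm) //= -z_dimQ_Aexpr z_dimQ z_affine // addrA.
rewrite (eq_big_nat _ _ (F2 := Aexpr (affine_coord k m))) ?subrr // => i /andP[i0 im].
by rewrite /Aexpr !z_affine // /dimQ; lia.
Qed.

(** The two partial sums add up to the equation of the quadric. The right-hand side involves only
    the free coordinates z_0, ..., z_{2m-2}, whereas B_j itself contains z_{2m-1}. *)
Lemma Bexpr_quadric j : (1 <= j <= m)%N ->
  B j = - (z 0 ^+ 2 + \sum_(1 <= l < j) A l).
Proof.
move=> /andP[j0 jm]; apply/eqP; rewrite -addr_eq0 addrC -addrA -big_cat_nat //.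
  by rewrite quadric_z.
exact: leqW.
Qed.

Lemma z_tofracX i : (i < dimQ m)%N ->
  z i = tofrac 'X_(inord i : 'I_(dimQ m)).
Proof. by move=> /z_affine. Qed.

Lemma ext_d_z i : (i < dimQ m)%N -> ext_d (z i) = dcoord k (inord i).
Proof. by move=> im; rewrite z_tofracX // ext_d_tofracX. Qed.

Lemma z_neq0 i : (i < dimQ m)%N -> z i != 0.
Proof.
move=> im; rewrite z_tofracX // tofrac_eq0; apply: contraTneq isT => X0.
have := congr1 (meval (fun=> 1)) X0.
by rewrite mevalXU meval0 => /eqP; rewrite oner_eq0.
Qed.

Lemma Bexpr_neq0 j : (1 <= j <= m)%N -> B j != 0.
Proof.
move=> jm; rewrite Bexpr_quadric // oppr_eq0.
pose X i : {mpoly k[dimQ m]} := 'X_(inord i).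
have -> : z 0 ^+ 2 + \sum_(1 <= l < j) A l =
    tofrac (X 0%N ^+ 2 + \sum_(1 <= l < j) X l.*2.-1 * X l.*2).
  rewrite (rmorphD (@tofrac _)) (rmorphXn (@tofrac _)) /= z_tofracX //.
  congr (_ + _); rewrite (rmorph_sum (@tofrac _)) !big_nat.
  apply: eq_bigr => l lj.
  by rewrite /Aexpr !z_tofracX ?(rmorphM (@tofrac _)) // /dimQ; lia.
rewrite tofrac_eq0; apply: contraTneq isT.
(* At the point with z_0 = 1 and all other coordinates 0 the polynomial takes the value 1, as every
   product X_{2l-1} X_{2l} with l >= 1 vanishes there. *)
move/(congr1 (meval (fun i : 'I_(dimQ m) => (i == ord0)%:R))).
rewrite rmorphD rmorphXn /= meval0 mevalXU.
rewrite (rmorph_sum (meval _)) big_nat big1 => [|l lj].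
  have -> : inord 0 = ord0 :> 'I_(dimQ m) by apply: val_inj; rewrite /= inordK.
  by rewrite eqxx expr1n addr0 => /eqP; rewrite oner_eq0.
rewrite /= rmorphM /= !mevalXU -val_eqE /= inordK; last by rewrite /dimQ; lia.
by rewrite (_ : _ == _ = false) ?mul0r //; lia.
Qed.

Lemma Aexpr_neq0 i : (1 <= i <= m)%N -> A i != 0.
Proof.
move=> /andP[i0]; rewrite leq_eqVlt => /predU1P[->|im].
  by rewrite -Bexpr_last Bexpr_neq0 // leqnn (ltnW hm).
by rewrite mulf_neq0 ?z_neq0 // /dimQ; lia.
Qed.

(** * Torus weights on the chart *)

Definition coord_weight i l : K :=
  if i == m then 1 else (l == i.*2.-1)%:R - (l == i.*2)%:R.

Lemma has_weight_z i l : (1 <= i <= m)%N -> (l < dimQ m)%N ->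
  has_weight (torus_field k (m := m) i) (z l) (coord_weight i l).
Proof.
move=> im lm; rewrite /has_weight ext_d_z // contract_dcoord /torus_field.
rewrite /coord_weight inordK //; case: eqP => _; first by rewrite mul1r.
case: eqP => [->|_].
  by rewrite (_ : _ == _ = false) ?subr0 ?mul1r //; lia.
by case: eqP => _; rewrite sub0r ?mulN1r // oppr0 mul0r.
Qed.

(** The common weight of z_0^2, the A_l and the B_j: 2 for the Euler field i = m, and 0 otherwise
    because the weights of z_{2l-1} and z_{2l} cancel. *)
Definition quad_weight i : K := if i == m then 1 + 1 else 0.

Lemma has_weight_sqr0 i : (1 <= i <= m)%N ->
  has_weight (torus_field k (m := m) i) (z 0 ^+ 2) (quad_weight i).
Proof.
move=> im; rewrite expr2.
have -> : quad_weight i = coord_weight i 0 + coord_weight i 0.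
  rewrite /quad_weight /coord_weight; case: eqP => // _.
  have [-> ->] : (0 == i.*2.-1) = false /\ (0 == i.*2) = false by lia.
  by rewrite subr0 addr0.
by apply: has_weightM; apply: has_weight_z.
Qed.

Lemma has_weight_Aexpr_lt i l : (1 <= i <= m)%N -> (1 <= l < m)%N ->
  has_weight (torus_field k (m := m) i) (A l) (quad_weight i).
Proof.
move=> im lm.
have -> : quad_weight i = coord_weight i l.*2.-1 + coord_weight i l.*2.
  rewrite /quad_weight /coord_weight; case: eqP => // _.
  have [-> ->] : (l.*2.-1 == i.*2) = false /\ (l.*2 == i.*2.-1) = false by lia.
  have -> : (l.*2.-1 == i.*2.-1) = (l.*2 == i.*2) by lia.
  by rewrite subr0 sub0r subrr.
by apply: has_weightM; apply: has_weight_z => //; rewrite /dimQ; lia.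
Qed.

(** Rewriting B_j by the quadric expresses it through z_0^2 and the A_l with l < m, whose weights
    come from the free coordinates; this includes B_m = A_m. *)
Lemma has_weight_Bexpr i j : (1 <= i <= m)%N -> (1 <= j <= m)%N ->
  has_weight (torus_field k (m := m) i) (B j) (quad_weight i).
Proof.
move=> im jm; rewrite Bexpr_quadric //; apply/has_weightN/has_weightD.
  exact: has_weight_sqr0.
apply: has_weight_sum => l; rewrite mem_index_iota => lj.
by apply: has_weight_Aexpr_lt => //; lia.
Qed.

(** * The one-forms dual to the torus fields *)

Definition beta l : form :=
  if l == m then dlog (z 0) else dlog (z l.*2.-1 / z 0).

Lemma one_form_beta l : one_form (beta l).
Proof. by rewrite /beta; case: ifP => _; apply: one_form_dlog. Qed.

(** For l < m, the coordinate z_{2l-1} has weight theta_l + theta_m and z_0 has weight theta_m, so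
    the quotient has weight theta_l. *)
Lemma contract_beta i l : (1 <= i <= m)%N -> (1 <= l <= m)%N ->
  contract (torus_field k (m := m) i) (beta l) set0 = (l == i)%:R.
Proof.
move=> im lm; have z00 := has_weight_z im (ltn0Sn _).
rewrite /beta; case: eqP => [->|/eqP nlm].
  rewrite (contract_dlog_weight (z_neq0 (ltn0Sn _)) z00) /coord_weight.
  rewrite [m == i]eq_sym; case: eqP => // _.
  have [-> ->] : (0 == i.*2.-1) = false /\ (0 == i.*2) = false by lia.
  by rewrite subr0.
have lQ : (l.*2.-1 < dimQ m)%N by rewrite /dimQ; lia.
have [zl z0] := (z_neq0 lQ, z_neq0 (ltn0Sn _)).
rewrite (contract_dlog_div zl z0 (has_weight_z im lQ) z00).
rewrite /coord_weight; case: eqP => [->|_].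
  by rewrite subrr (negPf nlm).
have [-> -> ->] : [/\ (0 == i.*2.-1) = false, (0 == i.*2) = false &
  (l.*2.-1 == i.*2) = false] by split; lia.
by rewrite !subr0; congr (nat_of_bool _)%:R; lia.
Qed.

Lemma contract_torus_beta (w : form) :
  (forall i, (1 <= i <= m)%N -> contract (torus_field k (m := m) i) w = 0) ->
  contract_torus (wedgel [seq beta l | l <- rev (index_iota 1 m.+1)] w) = w.
Proof.
rewrite /contract_torus /index_iota subn1 /= => Vw.
(* Induction on the number p of fields: V_{p+1} acts first and beta_{p+1} is leftmost, so the pair
   gives 1, while V_{p+1} kills the other beta_l and w. *)
suff main p : (p <= m)%N ->
    foldr (fun i => contract (torus_field k (m := m) i))
      (wedgel [seq beta l | l <- rev (iota 1 p)] w) (iota 1 p) = w.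
  exact: main.
elim: p => [//|p IHp] pm.
rewrite iota_rcons rev_rcons foldr_rcons add1n /=.
rewrite contract_wedge; last exact: one_form_beta.
rewrite contract_beta ?eqxx ?scale1f; try lia.
rewrite contract_wedgel_eq0 ?wedge0r ?subr0 ?IHp ?Vw //; try lia.
move=> a /mapP[l]; rewrite mem_rev mem_iota => lp ->.
split; first exact: one_form_beta.
have [p1 l1 /negPf lp1] : [/\ (1 <= p.+1 <= m)%N, (1 <= l <= m)%N & l != p.+1].
  by split; lia.
by rewrite contract_beta // lp1.
Qed.

(** * Reduction modulo dz_0 and the dz_{2l-1}, carried out by multiplying with [odd_form] *)

Definition odd_form : form :=
  wedgel [seq ext_d (z l.*2.-1) | l <- index_iota 1 m]
    (wedge (ext_d (z 0)) (form_one k (dimQ m))).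

Lemma wedge_z0_odd_form : wedge (ext_d (z 0)) odd_form = 0.
Proof.
apply: wedge_wedgel_eq0; first exact: one_form_ext_d.
  by move=> a /mapP[l _ ->]; apply: one_form_ext_d.
exact/wedge_one_form_sqr/one_form_ext_d.
Qed.

Lemma wedge_odd_form l : (1 <= l < m)%N ->
  wedge (ext_d (z l.*2.-1)) odd_form = 0.
Proof.
move=> lm; apply: wedge_wedgel_mem.
  by move=> a /mapP[i _ ->]; apply: one_form_ext_d.
by apply/mapP; exists l; rewrite ?mem_index_iota.
Qed.

Lemma ext_d_sqr0 :
  ext_d (z 0 ^+ 2) = scalef (z 0) (ext_d (z 0)) + scalef (z 0) (ext_d (z 0)).
Proof. by rewrite expr2 ext_dM. Qed.

Lemma wedge_sqr0_odd_form : wedge (ext_d (z 0 ^+ 2)) odd_form = 0.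
Proof.
by rewrite ext_d_sqr0 wedgeDl wedgeZl wedge_z0_odd_form scalef0 addr0.
Qed.

Lemma ext_d_Aexpr l : ext_d (A l) =
  scalef (z l.*2) (ext_d (z l.*2.-1)) + scalef (z l.*2.-1) (ext_d (z l.*2)).
Proof. exact: ext_dM. Qed.

(** With n = j + d, the product built so far is killed by dB_n, and dB_{n+1} = dB_n - dA_n, so the
    new factor acts as - z_{2n-1} dz_{2n}. The first conclusion carries the killing by dB_n through
    the induction. *)
Lemma wedgel_Bexpr_chain (j d : nat) (w : form) : (j + d <= m)%N ->
  wedge (ext_d (B j)) w = 0 ->
  (forall l, (j <= l < j + d)%N -> wedge (ext_d (z l.*2.-1)) w = 0) ->
  let W := wedgel [seq ext_d (B l.+1) | l <- rev (iota j d)] w in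
  wedge (ext_d (B (j + d))) W = 0 /\
  eq_up_to_sign W (scalef (\prod_(l <- iota j d) z l.*2.-1)
    (wedgel [seq ext_d (z l.*2) | l <- rev (iota j d)] w)).
Proof.
elim: d => [|d IHd] jd Bw zw W; rewrite {}/W.
  by rewrite addn0 /= big_nil scale1f; split; last left.
have [jd' zw'] : (j + d <= m)%N /\
    forall l, (j <= l < j + d)%N -> wedge (ext_d (z l.*2.-1)) w = 0.
  by split=> [|l lj]; [lia | apply: zw; lia].
have [BW WE] := IHd jd' Bw zw'.
rewrite iota_rcons rev_rcons addnS /=.
split; first exact/wedge_one_form_sqr/one_form_ext_d.
rewrite -cats1 big_cat big_seq1 /=.
set n := (j + d)%N; set W := wedgel _ _ in BW WE *.
have -> : ext_d (B n.+1) = ext_d (B n) - ext_d (A n).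
  have nm : (n <= m)%N := jd'.
  by rewrite (Bexpr_recl nm) ext_dD addrC addKr.
have zW : wedge (ext_d (z n.*2.-1)) W = 0.
  apply: wedge_wedgel_eq0; [exact: one_form_ext_d| |by apply: zw; lia].
  by move=> a /mapP[l _ ->]; apply: one_form_ext_d.
rewrite wedgeDl BW add0r wedgeNl ext_d_Aexpr wedgeDl !wedgeZl zW scalef0 add0r.
apply: (@eq_up_to_sign_trans _ _ _ (scalef (z n.*2.-1) (wedge (ext_d (z n.*2)) W))).
  by right.
rewrite mulrC -scalefA; apply: eq_up_to_sign_scalef.
by rewrite -wedgeZr; apply: eq_up_to_sign_wedge.
Qed.

End Chart.

(** * Comparison of [Omega] with the product of logarithmic forms *)

Section Proposition.
Variables (k : fieldType) (m : nat).
Hypothesis hm : (2 <= m)%N.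
Local Notation form := (Defs.form k (dimQ m)).
Local Notation z := (z k m).
Local Notation A := (Aexpr z).
Local Notation B := (Bexpr m z).
Local Notation one := (form_one k (dimQ m)).
Implicit Types (i j l : nat).

Lemma index_iota1_rcons : index_iota 1 m.+1 = rcons (index_iota 1 m) m.
Proof.
rewrite /index_iota subn1 /= -{1}(prednK (ltnW hm)) iota_rcons subn1.
by rewrite add1n prednK // ltnW.
Qed.

(** Each induction step adds 2p+1 on the odd side and 2p+2 on the even side; comparing counts of a
    predicate ignores the order. *)
Lemma perm_even_odd (p : nat) :
  perm_eq ([seq l.*2 | l <- iota 1 p] ++ [seq l.*2.-1 | l <- iota 1 p] ++ [:: 0%N])
          (iota 0 p.*2.+1).
Proof.
apply/permP => P; elim: p => [//|p]; rewrite doubleS.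
rewrite !iota_rcons -!cats1 !map_cat !count_cat /= !add0n !add1n doubleS /=.
by lia.
Qed.

Lemma wedgel_dlog_quotients (I : eqType) (s : seq I)
    (f : I -> {fraction {mpoly k[dimQ m]}}) (w : form) :
  (forall x, x \in s -> f x != 0) -> wedge (ext_d (B m)) w = 0 ->
  wedgel [seq dlog (f x / B m) | x <- s] w =
  scalef (\prod_(x <- s) f x)^-1 (wedgel [seq ext_d (f x) | x <- s] w).
Proof.
move=> f0 Bw; have B0 : B m != 0 by apply: Bexpr_neq0; rewrite ?leqnn ?(ltnW hm).
rewrite -prodfV; apply: wedgel_reduce => [x|x xs]; first exact: one_form_ext_d.
exists (scalef (- (B m)^-1) (ext_d (B m))).
  by rewrite (dlog_div (f0 x xs) B0) scaleNf.
split; first exact/one_formZ/one_form_ext_d.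
by rewrite wedgeZl Bw scalef0.
Qed.

(** The part 2 dz_0 / z_0 is killed by [odd_form]. The factor dB_m that remains is what removes the
    B_m terms from the other logarithmic forms. *)
Lemma wedge_dlog_sqr0 :
  wedge (dlog (z 0 ^+ 2 / B m)) (odd_form k m) =
  scalef (- (B m)^-1) (wedge (ext_d (B m)) (odd_form k m)).
Proof.
have B0 : B m != 0 by apply: Bexpr_neq0; rewrite ?leqnn ?(ltnW hm).
have z0 : z 0 ^+ 2 != 0 := expf_neq0 2 (z_neq0 k (ltn0Sn _)).
rewrite (dlog_div z0 B0) wedgeDl wedgeNl !wedgeZl scaleNf.
by rewrite wedge_sqr0_odd_form scalef0 add0r.
Qed.

(** The factor beta_m supplies dz_0, modulo which beta_l is dz_{2l-1} / z_{2l-1}. *)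
Lemma wedgel_beta :
  wedgel [seq beta k m l | l <- index_iota 1 m] (wedge (beta k m m) one) =
  scalef (z 0 * \prod_(1 <= l < m) z l.*2.-1)^-1 (odd_form k m).
Proof.
have z0 : z 0 != 0 := z_neq0 k (ltn0Sn _).
have -> : wedge (beta k m m) one = scalef (z 0)^-1 (wedge (ext_d (z 0)) one).
  by rewrite /beta eqxx wedgeZl.
rewrite wedgelZ invfM -scalefA; congr scalef.
rewrite -prodfV; apply: wedgel_reduce => [l|l]; first exact: one_form_ext_d.
rewrite mem_index_iota => lm.
exists (scalef (- (z 0)^-1) (ext_d (z 0))).
  rewrite /beta (_ : (l == m) = false); last by lia.
  have zl : z l.*2.-1 != 0 by apply: z_neq0; rewrite /dimQ; lia.
  by rewrite (dlog_div zl z0) scaleNf.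
split; first exact/one_formZ/one_form_ext_d.
by rewrite wedgeZl (wedge_one_form_sqr one (one_form_ext_d (z 0))) scalef0.
Qed.

Lemma wedgel_dlogs j : (2 <= j <= m)%N ->
  eq_up_to_sign
    (wedgel [seq beta k m l | l <- rev (index_iota 1 m.+1)]
       (wedges (dlog (z 0 ^+ 2 / B m)
              :: [seq dlog (A i / B m) | i <- index_iota 2 j]
              ++ [seq dlog (B i / B m) | i <- index_iota j m])))
    (scalef ((\prod_(j <= i < m) B i)^-1 * (\prod_(2 <= i < j) A i)^-1 *
             (B m)^-1 * (z 0 * \prod_(1 <= l < m) z l.*2.-1)^-1)
       (wedgel [seq ext_d (B i) | i <- index_iota j m]
         (wedgel [seq ext_d (A i) | i <- index_iota 2 j]
           (wedge (ext_d (B m)) (odd_form k m))))).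
Proof.
move=> jm; set sb := [seq beta _ _ _ | _ <- _].
set sA := [seq dlog _ | i <- index_iota 2 j].
set sB := [seq dlog _ | i <- index_iota j m].
set h := dlog _.
have one_l a : a \in sb ++ h :: sA ++ sB -> one_form a.
  rewrite mem_cat inE mem_cat => /orP[/mapP[l _ ->]|/orP[/eqP ->|/orP[]/mapP[l _ ->]]];
  by [apply: one_form_beta | apply: one_form_dlog].
pose sb' := [seq beta k m l | l <- index_iota 1 m].
(* The beta's are placed innermost, then the form with z_0^2, then the A's and B's: each group is
   reduced modulo what stands to its right. *)
have pm : perm_eq (sb ++ h :: sA ++ sB) (sB ++ sA ++ h :: sb' ++ [:: beta k m m]).
  apply/permP => P; rewrite /sb index_iota1_rcons map_rev map_rcons -cats1 -/sb'.
  rewrite !(count_cat, count_rev) /= !count_cat /=; lia.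
have := wedgel_perm one one_l pm; rewrite wedgel_cat.
move/eq_up_to_sign_trans; apply.
rewrite wedgel_cat wedgel_cat /= wedgel_cat /= wedgel_beta.
set w := wedge (ext_d (B m)) (odd_form k m).
have Bw : wedge (ext_d (B m)) w = 0 by exact/wedge_one_form_sqr/one_form_ext_d.
have BAw : wedge (ext_d (B m)) (wedgel [seq ext_d (A i) | i <- index_iota 2 j] w) = 0.
  apply: wedge_wedgel_eq0 Bw => [|a /mapP[l _ ->]]; exact: one_form_ext_d.
rewrite wedgeZr wedge_dlog_sqr0 -/w !wedgelZ.
rewrite /sA (wedgel_dlog_quotients _ Bw) => [|i]; last first.
  by rewrite mem_index_iota => ij; apply: (Aexpr_neq0 k hm); lia.
rewrite !wedgelZ /sB (wedgel_dlog_quotients _ BAw) => [|i]; last first.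
  by rewrite mem_index_iota => ij; apply: (Bexpr_neq0 k hm); lia.
right; rewrite !scalefA -scaleNf; congr scalef.
set a := (\prod_(_ <- _) A _)^-1; set b := (\prod_(_ <- _) B _)^-1.
set c := (z 0 * _)^-1; set e := (B m)^-1.
by ring.
Qed.

(** After [Bexpr_quadric], [odd_form] kills d(z_0^2), the dA_l with 2 <= l < j repeat factors of w,
    and from dA_1 only z_1 dz_2 is left. *)
Lemma wedge_Bexpr_first j : (2 <= j <= m)%N ->
  let w := wedgel [seq ext_d (A i) | i <- index_iota 2 j] (odd_form k m) in
  wedge (ext_d (B j)) w = - scalef (z 1) (wedge (ext_d (z 2)) w).
Proof.
move=> jm w.
have one_A a : a \in [seq ext_d (A i) | i <- index_iota 2 j] -> one_form a.
  by move=> /mapP[l _ ->]; apply: one_form_ext_d.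
have kill f : wedge (ext_d f) (odd_form k m) = 0 -> wedge (ext_d f) w = 0.
  by apply: wedge_wedgel_eq0 => //; apply: one_form_ext_d.
have jm' : (1 <= j <= m)%N by lia.
have -> : B j = - (z 0 ^+ 2 + (A 1 + \sum_(2 <= l < j) A l)).
  by rewrite (Bexpr_quadric k hm jm') big_ltn //; lia.
rewrite ext_dN wedgeNl !ext_dD !wedgeDl kill ?wedge_sqr0_odd_form // add0r.
congr (- _); rewrite ext_d_Aexpr wedgeDl !wedgeZl kill; last first.
  by apply: (wedge_odd_form k (l := 1)).
rewrite scalef0 add0r ext_d_sum wedge_suml big_seq big1 ?addr0 // => l lj.
by apply: wedge_wedgel_mem => //; apply/mapP; exists l.
Qed.

Lemma wedgel_Aexpr j : (j <= m)%N ->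
  wedgel [seq ext_d (A i) | i <- index_iota 2 j] (odd_form k m) =
  scalef (\prod_(2 <= i < j) z i.*2.-1)
    (wedgel [seq ext_d (z i.*2) | i <- index_iota 2 j] (odd_form k m)).
Proof.
move=> jm; apply: wedgel_reduce => [i|i]; first exact: one_form_ext_d.
rewrite mem_index_iota => ij.
exists (scalef (z i.*2) (ext_d (z i.*2.-1))); first by rewrite ext_d_Aexpr addrC.
split; first exact/one_formZ/one_form_ext_d.
by rewrite wedgeZl wedge_odd_form ?scalef0 //; lia.
Qed.

(** Every coordinate occurs exactly once: the even indices from 2j to 2m-2, then 2, then 4 to 2j-2,
    then the odd indices and 0. *)
Lemma wedgel_volume j : (2 <= j <= m)%N ->
  eq_up_to_sign
    (wedgel [seq ext_d (z l.*2) | l <- rev (index_iota j m)]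
      (wedge (ext_d (z 2))
        (wedgel [seq ext_d (z i.*2) | i <- index_iota 2 j] (odd_form k m))))
    (volume_form k m).
Proof.
move=> jm; rewrite /volume_form.
have -> : wedges [seq ext_d (z i) | i <- index_iota 0 (dimQ m)] =
  wedgel [seq ext_d (z i) | i <- index_iota 0 (dimQ m)] one by [].
pose s := [seq l.*2 | l <- rev (index_iota j m) ++ 1%N :: index_iota 2 j] ++
  [seq l.*2.-1 | l <- index_iota 1 m] ++ [:: 0%N].
have ps : perm_eq s (index_iota 0 (dimQ m)).
  rewrite /index_iota subn0 /dimQ.
  apply: perm_trans (perm_even_odd m.-1); rewrite /s.
  have -> : index_iota 1 m = iota 1 m.-1 by rewrite /index_iota subn1.
  rewrite perm_cat2r; apply: perm_map.
  have -> : iota 1 m.-1 = (1%N :: index_iota 2 j) ++ index_iota j m.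
    have -> : m.-1 = ((j - 2).+1 + (m - j))%N by lia.
    rewrite iotaD /= /index_iota; congr (_ :: _ ++ iota _ _); lia.
  by rewrite perm_catC perm_cat2l perm_rev.
have one_s a : a \in [seq ext_d (z i) | i <- s] -> one_form a.
  by move=> /mapP[l _ ->]; apply: one_form_ext_d.
have := wedgel_perm one one_s (perm_map (fun i => ext_d (z i)) ps).
by rewrite /s !map_cat -!map_comp !wedgel_cat.
Qed.

Lemma wedgel_ext_d j : (2 <= j <= m)%N ->
  eq_up_to_sign
   (wedgel [seq ext_d (B i) | i <- index_iota j m]
     (wedgel [seq ext_d (A i) | i <- index_iota 2 j]
       (wedge (ext_d (B m)) (odd_form k m))))
   (scalef (\prod_(1 <= l < m) z l.*2.-1) (volume_form k m)).
Proof.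
move=> jm; have jE : (j + (m - j) = m)%N by lia.
pose w := wedgel [seq ext_d (A i) | i <- index_iota 2 j] (odd_form k m).
pose l1 := [seq ext_d (B i) | i <- index_iota j m] ++
  [seq ext_d (A i) | i <- index_iota 2 j] ++ [:: ext_d (B m)].
(* Reordered as dB_m, ..., dB_{j+1}, dB_j, followed by the dA_i, the product starts the chain from
   dB_j. *)
pose l2 := [seq ext_d (B l.+1) | l <- rev (iota j (m - j))] ++
  ext_d (B j) :: [seq ext_d (A i) | i <- index_iota 2 j].
have one_l a : a \in l1 -> one_form a.
  rewrite !mem_cat inE => /orP[|/orP[|/eqP ->]].
  - by move=> /mapP[l _ ->]; apply: one_form_ext_d.
  - by move=> /mapP[l _ ->]; apply: one_form_ext_d.
  - exact: one_form_ext_d.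
have pl : perm_eq l1 l2.
  have e : iota j (m - j) ++ [:: m] = j :: [seq l.+1 | l <- iota j (m - j)].
    rewrite -[in [:: m]]jE cats1 -iota_rcons /= -[j.+1]add1n iotaDl.
    by congr (_ :: _); apply: eq_map.
  apply/permP => P.
  have eP : (count P [seq ext_d (B i) | i <- iota j (m - j)] + P (ext_d (B m)) =
      P (ext_d (B j)) + count P [seq ext_d (B l.+1) | l <- iota j (m - j)])%N.
    have := congr1 (fun s => count P [seq ext_d (B i) | i <- s]) e.
    by rewrite map_cat count_cat /= addn0 -map_comp.
  rewrite /l1 /l2 !count_cat map_rev count_rev /= addn0.
  by rewrite [(_ + P _)%N]addnC addnA eP addnAC addnC.
have := wedgel_perm (odd_form k m) one_l pl.
rewrite /l1 /l2 !wedgel_cat /= -/w => /eq_up_to_sign_trans; apply.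
have Bw : wedge (ext_d (B j)) (wedge (ext_d (B j)) w) = 0.
  exact/wedge_one_form_sqr/one_form_ext_d.
have zw l : (j <= l < j + (m - j))%N ->
    wedge (ext_d (z l.*2.-1)) (wedge (ext_d (B j)) w) = 0.
  rewrite jE => lj.
  have zo : wedge (ext_d (z l.*2.-1)) (odd_form k m) = 0.
    by apply: wedge_odd_form; lia.
  have zA : wedge (ext_d (z l.*2.-1)) w = 0.
    by apply: wedge_wedgel_eq0 zo => [|a /mapP[i _ ->]]; apply: one_form_ext_d.
  by rewrite wedge_one_form_anti ?zA ?wedge0r ?oppr0 //; apply: one_form_ext_d.
have jm' : (j + (m - j) <= m)%N by rewrite jE.
have [_] := wedgel_Bexpr_chain hm jm' Bw zw.
move/eq_up_to_sign_trans; apply.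
rewrite wedge_Bexpr_first // wedgel_Aexpr; last by lia.
rewrite wedgeZr scalefA -scaleNf wedgelZ scalefA.
set p1 := \prod_(_ <- _) _; set p2 := \prod_(_ <= _ < _) _.
(* The factor l = 1 comes from dB_j, those with 2 <= l < j from the dA_i, and those with j <= l < m
   from the chain. *)
have -> : \prod_(1 <= l < m) z l.*2.-1 = p1 * (z 1 * p2).
  rewrite big_ltn // (big_cat_nat _ (n := j)) /=; [|lia|lia].
  by rewrite mulrA mulrC.
rewrite mulrN scaleNf.
apply: (eq_up_to_sign_trans (or_intror erefl)).
exact/eq_up_to_sign_scalef/wedgel_volume.
Qed.

(** The odd coordinates produced by the differentials cancel those in the denominators of the
    beta's; the remaining coefficient is that of [Omega], because z_{2m-1} = B_m. *)
Lemma Omega_dlogs j : (2 <= j <= m)%N ->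
  eq_up_to_sign (Omega k m j)
    (wedgel [seq beta k m l | l <- rev (index_iota 1 m.+1)]
       (wedges (dlog (z 0 ^+ 2 / B m)
              :: [seq dlog (A i / B m) | i <- index_iota 2 j]
              ++ [seq dlog (B i / B m) | i <- index_iota j m]))).
Proof.
move=> jm; apply/eq_up_to_sign_sym/(eq_up_to_sign_trans (wedgel_dlogs jm)).
set c := _^-1 * _ * _ * _.
apply: (eq_up_to_sign_trans (eq_up_to_sign_scalef c (wedgel_ext_d jm))).
left; rewrite scalefA /Omega; congr scalef; rewrite /c.
have -> : z m.*2.-1 = B m.
  by rewrite (Bexpr_last k m) -(z_dimQ_Aexpr k hm); congr z; rewrite /dimQ; lia.
have o0 : \prod_(1 <= l < m) z l.*2.-1 != 0.
  rewrite big_seq prodf_seq_neq0; apply/allP => l; rewrite mem_index_iota => lm.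
  by apply/implyP => _; apply: z_neq0; rewrite /dimQ; lia.
rewrite [X in _ * X * _ = _]invfM !mulrA (divfK o0) !invfM.
set a := (\prod_(_ <- _) A _)^-1; set b := (\prod_(_ <- _) B _)^-1.
set e := (z 0)^-1; set f := (B m)^-1.
by ring.
Qed.

Lemma contract_torus_Omega j : (2 <= j <= m)%N ->
  eq_up_to_sign (contract_torus (Omega k m j))
       (wedges (dlog (z 0 ^+ 2 / B m)
              :: [seq dlog (A i / B m) | i <- index_iota 2 j]
              ++ [seq dlog (B i / B m) | i <- index_iota j m])).
Proof.
move=> jm.
have torusN w : contract_torus (- w) = - contract_torus w.
  by rewrite /contract_torus; elim: (index_iota _ _) => //= i s ->; rewrite contractN.
set l := (_ :: _); set H := wedges l.
have VH i : (1 <= i <= m)%N -> contract (torus_field k (m := m) i) H = 0.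
  move=> im; rewrite -[H]/(wedgel l one).
  apply: contract_wedgel_eq0 (contract_form_one _) => a.
  have B0 : B m != 0 by apply: (Bexpr_neq0 k hm); rewrite leqnn (ltnW hm).
  have mm : (1 <= m <= m)%N by lia.
  have Bw := has_weight_Bexpr k hm im mm.
  (* All numerators share the weight of [B m], so each logarithmic form vanishes on every torus
     field. *)
  have dead f : f != 0 ->
      has_weight (torus_field k (m := m) i) f (quad_weight k m i) ->
      one_form (dlog (f / B m)) /\
      contract (torus_field k (m := m) i) (dlog (f / B m)) set0 = 0.
    move=> f0 fw; split; first exact: one_form_dlog.
    by rewrite (contract_dlog_div f0 B0 fw Bw) subrr.
  rewrite inE mem_cat => /orP[/eqP ->|/orP[]/mapP[i0]]; rewrite ?mem_index_iota.
  - apply: dead; last exact: has_weight_sqr0.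
    exact: expf_neq0 (z_neq0 k (ltn0Sn _)).
  - move=> lj ->; apply: dead; first by apply: (Aexpr_neq0 k hm); lia.
    by apply: has_weight_Aexpr_lt => //; lia.
  - move=> lj ->; apply: dead; first by apply: (Bexpr_neq0 k hm); lia.
    by apply: has_weight_Bexpr => //; lia.
have VbH := contract_torus_beta hm VH.
case: (Omega_dlogs jm) => ->; rewrite -/H ?torusN VbH; [by left | by right].
Qed.

End Proposition.

Theorem proposition3p10 (R : realType) (m : nat) (hm : (2 <= m)%N) :
  let x := hcoord R[i] m in
  let A := Aexpr x in
  let B := Bexpr m x in
  [/\ forall j : nat, (2 <= j <= m)%N ->
        eq_up_to_sign
          (contract_torus (Omega R[i] m j))
          (wedges
             (dlog (hratio (x 0%N ^+ 2) (B m))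
              :: [seq dlog (hratio (A i) (B m)) | i <- index_iota 2 j]
              ++ [seq dlog (hratio (B i) (B m)) | i <- index_iota j m])),
      eq_up_to_sign
        (contract_torus (Omega_Sch R[i] m))
        (wedges
           (dlog (hratio (x 0%N ^+ 2) (A m))
            :: [seq dlog (hratio (A i) (A m)) | i <- index_iota 2 m]))
    & eq_up_to_sign
        (contract_torus (Omega_Rie R[i] m))
        (wedges
           (dlog (hratio (x 0%N ^+ 2) (B m))
            :: [seq dlog (hratio (B i) (B m)) | i <- index_iota 2 m]))].
Proof.
move=> x A B.
have dlogE j : (2 <= j <= m)%N ->
    eq_up_to_sign (contract_torus (Omega R[i] m j))
      (wedges (dlog (hratio (x 0%N ^+ 2) (B m))
              :: [seq dlog (hratio (A i) (B m)) | i <- index_iota 2 j]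
              ++ [seq dlog (hratio (B i) (B m)) | i <- index_iota j m])).
  move=> jm; have := contract_torus_Omega R[i] hm jm.
  rewrite /hratio /A /B /x restrict_sqr0 !restrict_Bexpr.
  congr (eq_up_to_sign _ (wedges (_ :: _ ++ _))).
    apply/eq_in_map => i; rewrite mem_index_iota => ij.
    by rewrite restrict_Aexpr //; lia.
  by apply: eq_map => i; rewrite restrict_Bexpr.
(* This turns the case j = m, where the range of B's is empty, into the formula for [Omega_Sch]. *)
have AB : A m = B m by rewrite /B /Bexpr big_nat1.
have [m2 mm] : (2 <= 2 <= m)%N /\ (2 <= m <= m)%N by split; lia.
split=> //.
- have mm0 : index_iota m m = [::] by rewrite /index_iota subnn.
  by rewrite AB; have := dlogE m mm; rewrite mm0 cats0.
- exact: (dlogE 2 m2).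
Qed.
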